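(* For $\eta\geq 0$ let $$q_\eta(w,x,y,z)=w^4+x^2y^2+y^2z^2+z^2x^2-4wxyz+\eta(x^4+y^4+z^4)\in\mathbb{R}[w,x,y,z],$$ and let $\eta_0>0$ be the smallest value of $\eta$ for which $q_\eta$ is a sum of squares of forms in $\mathbb{R}[w,x,y,z]$. Then $\sqrt{\eta_0}$ is the smallest positive root of $X^3-\frac{1}{2}X+\frac{1}{9}=0$, $$q_{\eta_0}(w,x,y,z)=\bigl(w^2-\sqrt{\eta_0}(x^2+y^2+z^2)\bigr)^2+\frac{2}{9\sqrt{\eta_0}}\Bigl[(3\sqrt{\eta_0}\,wx-yz)^2+(3\sqrt{\eta_0}\,wy-zx)^2+(3\sqrt{\eta_0}\,wz-xy)^2\Bigr],$$ and there is exactly one Gram matrix that represents $q_{\eta_0}$.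
   Context: A form is a homogeneous polynomial. For a form $f\in\mathbb{R}[x_1,\ldots,x_n]$ of degree $2p$, a representation matrix of $f$ is a real symmetric matrix $\mathcal{G}=(\mathcal{G}_{\alpha\beta})$ with rows and columns indexed by the multi-indices $\alpha\in\mathbb{N}_0^n$ of order $|\alpha|=p$ such that $f(\mathbf{x})=\sum_{|\alpha|=|\beta|=p}\mathcal{G}_{\alpha\beta}\,\mathbf{x}^{\alpha}\mathbf{x}^{\beta}$. A Gram matrix for (representing) $f$ is a positive semi-definite representation matrix of $f$. *)

(* Defs.v *)
From mathcomp Require Export all_boot all_order all_algebra.
From mathcomp Require Export reals.
From mathcomp Require Export mpoly.

Set Implicit Arguments.
Unset Strict Implicit.
Unset Printing Implicit Defensive.

Import Order.TTheory GRing.Theory Num.Theory.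
Local Open Scope ring_scope.

Definition midx (n p : nat) : finType := {m : 'X_{1..n < p.+1} | mdeg m == p}.

(* Matrices are indexed by ordinals, so rows and columns are numbered along the
   enumeration of [midx n p]; [midx_val i] is the i-th multi-index. *)
Definition midx_val (n p : nat) (i : 'I_#|midx n p|) : 'X_{1..n} :=
  bmnm (val (enum_val i)).

Section Gram.
Variable R : realType.

Definition psdmx (k : nat) (A : 'M[R]_k) : Prop :=
  A^T = A /\ forall v : 'rV[R]_k, 0 <= (v *m A *m v^T) 0 0.

Definition representation_matrix (n p : nat) (f : {mpoly R[n]})
    (G : 'M[R]_#|midx n p|) : Prop :=
  G^T = G /\
  f = \sum_i \sum_j G i j *: ('X_[midx_val i] * 'X_[midx_val j]).

Definition gram_matrix (n p : nat) (f : {mpoly R[n]})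
    (G : 'M[R]_#|midx n p|) : Prop :=
  representation_matrix f G /\ psdmx G.

(* The summands are forms of arbitrary, possibly different, degrees. *)
Definition sos_forms (n : nat) (f : {mpoly R[n]}) : Prop :=
  exists s : seq {mpoly R[n]},
    (forall g, g \in s -> exists d, g \is d.-homog) /\
    f = \sum_(g <- s) g ^+ 2.

Definition Vw : {mpoly R[4]} := 'X_(@Ordinal 4 0 isT).
Definition Vx : {mpoly R[4]} := 'X_(@Ordinal 4 1 isT).
Definition Vy : {mpoly R[4]} := 'X_(@Ordinal 4 2 isT).
Definition Vz : {mpoly R[4]} := 'X_(@Ordinal 4 3 isT).

Definition q_form (eta : R) : {mpoly R[4]} :=
  Vw ^+ 4 + Vx ^+ 2 * Vy ^+ 2 + Vy ^+ 2 * Vz ^+ 2 + Vz ^+ 2 * Vx ^+ 2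
  - 4%:R *: (Vw * Vx * Vy * Vz)
  + eta *: (Vx ^+ 4 + Vy ^+ 4 + Vz ^+ 4).

Definition least_sos_eta (eta0 : R) : Prop :=
  [/\ 0 <= eta0, sos_forms (q_form eta0)
    & forall eta, 0 <= eta -> sos_forms (q_form eta) -> eta0 <= eta].

Definition smallest_pos_root (P : {poly R}) (t : R) : Prop :=
  [/\ 0 < t, root P t & forall u, 0 < u -> root P u -> t <= u].

End Gram.

Arguments Vw {R}.
Arguments Vx {R}.
Arguments Vy {R}.
Arguments Vz {R}.

(* Main.v *)
From mathcomp Require Import ring lra.
Require Import Defs.
Import Order.TTheory GRing.Theory Num.Theory.
Local Open Scope ring_scope.

(** The cubic 'X^3 - 'X / 2 + 1 / 9 has a root [s] in ]0, 1/3[, and it is its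
    least positive root.  The displayed decomposition of [q_form (s ^+ 2)] is an
    identity modulo the cubic ([q_form_decomposition]), so this form is a sum of
    squares and has a Gram matrix.

    Everything else is semidefinite duality.  Let [moment s] be the linear
    functional on quartic coefficients which takes the values
      w^4: 3s,  w^2 x^2: 1,  x^4: 1/s - 18 s^2,  x^2 y^2: 9 s^2,  w x y z: 3s
    (and those forced by permuting x, y, z), and 0 on the other quartic
    monomials.  It is chosen so that it vanishes on the squares of the four
    forms of the decomposition.  Its moment matrix, indexed by the ten quadratic
    monomials, is a positively weighted sum of squares of linear forms when
    3s < 1 ([moment_gram]), so [moment s] is nonnegative on sums of squares and
    on forms with a Gram matrix ([moment_sos_ge0]).  As
      moment s (q_form eta) = 3 (1/s - 18 s^2) (eta - s^2)
    with a positive factor, no [q_form eta] with eta < s^2 is a sum of squares.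

    For eta = s^2 the moment is 0 (complementary slackness): a Gram matrix must
    be isotropic, hence zero, on the range of the moment matrix
    ([moment_gram_kernel]).  This leaves matrices supported on the span of the
    four forms of the decomposition, whose ten pairwise products are linearly
    independent; so the difference of two Gram matrices, which represents the
    zero form, is zero ([representation_matrix0_kernel]). *)

Set Implicit Arguments.
Unset Strict Implicit.
Unset Printing Implicit Defensive.

(** * Kernels of positive semidefinite matrices *)

Section PsdKernel.
Variable R : realType.

(** Along the line [u + t v] with [u = v A] the quadratic form of [A] is affine
    in [t], with slope [2 |u|^2]; being nonnegative it has slope zero. *)
Lemma psdmx_isotropic_kernel k (A : 'M[R]_k) (v : 'rV[R]_k) :
  psdmx A -> (v *m A *m v^T) 0 0 = 0 -> v *m A = 0.
Proof.
move=> [symA psdA] vAv0.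
set u := v *m A.
have uu_ge0 : 0 <= (u *m u^T) 0 0.
  by rewrite mxE sumr_ge0 // => i _; rewrite [u^T _ _]mxE -expr2 sqr_ge0.
have cross : (u *m A *m v^T) 0 0 = (u *m u^T) 0 0.
  by rewrite -mulmxA -[A in LHS]symA -trmx_mul.
have line t : 0 <= (u *m A *m u^T) 0 0 + 2 * t * (u *m u^T) 0 0.
  have := psdA (u + t *: v).
  rewrite linearD linearZ /= !(mulmxDl, mulmxDr) -!scalemxAl -!scalemxAr -/u.
  have addE (B C : 'M[R]_1) : (B + C) 0 0 = B 0 0 + C 0 0 by rewrite mxE.
  have scaleE c (B : 'M[R]_1) : (c *: B) 0 0 = c * B 0 0 by rewrite mxE.
  rewrite !(addE, scaleE) cross [(u *m v^T) 0 0]vAv0.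
  by congr (0 <= _); ring.
have uu0 : (u *m u^T) 0 0 = 0.
  apply/eqP/negPn/negP => uu_neq0.
  have := line (- ((u *m A *m u^T) 0 0 + 1) / (2 * (u *m u^T) 0 0)).
  set b := (u *m u^T) 0 0 in uu_neq0 *; set c := (u *m A *m u^T) 0 0.
  suff -> : c + 2 * (- (c + 1) / (2 * b)) * b = -1 by rewrite ler0N1.
  by field.
apply/rowP => i; rewrite [RHS]mxE.
move/eqP: uu0; rewrite mxE psumr_eq0; last first.
  by move=> j _; rewrite [u^T _ _]mxE -expr2 sqr_ge0.
by move=> /allP /(_ i (mem_index_enum i));
  rewrite [u^T _ _]mxE mulf_eq0 orbb => /eqP.
Qed.

End PsdKernel.

(** * Representation matrices and their coefficients *)

Section Forms.
Variables (R : realType) (n p : nat).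
Local Notation N := #|midx n p|.
Implicit Types (f g : {mpoly R[n]}) (G : 'M[R]_N) (a b m : 'X_{1..n}).

Lemma midx_val_inj : injective (@midx_val n p).
Proof. by move=> i j /val_inj /val_inj /enum_val_inj. Qed.

Lemma mdeg_midx_val (i : 'I_N) : mdeg (midx_val i) = p.
Proof. exact/eqP/(valP (enum_val i)). Qed.

Lemma midx_val_surj m : mdeg m = p -> exists i : 'I_N, midx_val i = m.
Proof.
move=> dm; have lt_m : (mdeg m < p.+1)%N by rewrite dm.
have em : mdeg (BMultinom lt_m) == p by apply/eqP.
pose x : midx n p := Sub (BMultinom lt_m) em.
by exists (enum_rank x); rewrite /midx_val enum_rankK.
Qed.

Definition bil G (u v : 'rV[R]_N) : R := (u *m G *m v^T) 0 0.

(** The unit vector of the multi-index [m].  It is zero when [m] does not have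
    degree [p]; [representation_coef] relies on this default value. *)
Definition evec m : 'rV[R]_N := \row_j (midx_val j == m)%:R.

Lemma bilDl G u v w : bil G (u + v) w = bil G u w + bil G v w.
Proof. by rewrite /bil !mulmxDl mxE. Qed.
Lemma bilDr G u v w : bil G w (u + v) = bil G w u + bil G w v.
Proof. by rewrite /bil linearD mulmxDr mxE. Qed.
Lemma bilZl G c u v : bil G (c *: u) v = c * bil G u v.
Proof. by rewrite /bil -!scalemxAl mxE. Qed.
Lemma bilZr G c u v : bil G u (c *: v) = c * bil G u v.
Proof. by rewrite /bil linearZ -scalemxAr mxE. Qed.
Lemma bilC G u v : G^T = G -> bil G u v = bil G v u.
Proof.
move=> symG; rewrite /bil -[in LHS](trmxK (u *m G *m v^T)) [in LHS]mxE.
by rewrite !trmx_mul trmxK symG mulmxA.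
Qed.
Definition bilE := (bilDl, bilDr, bilZl, bilZr).

Lemma evec_midx_val (i : 'I_N) : evec (midx_val i) = delta_mx 0 i.
Proof. by apply/rowP=> j; rewrite !mxE (inj_eq midx_val_inj). Qed.

Lemma bil_evec G i j : bil G (evec (midx_val i)) (evec (midx_val j)) = G i j.
Proof. by rewrite /bil !evec_midx_val -rowE trmx_delta -colE !mxE. Qed.

(** Given the row [midx_val i], the only column that contributes to the
    coefficient of [m] is [m - midx_val i]. *)
Lemma representation_coef f G m : representation_matrix f G ->
  f@_m = \sum_(i : 'I_N | (midx_val i <= m)%MM)
           bil G (evec (midx_val i)) (evec (m - midx_val i)%MM).
Proof.
case=> _ ->; rewrite raddf_sum [RHS]big_mkcond; apply: eq_bigr => i _ /=.
rewrite raddf_sum /=.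
case: ifP => [le_im | nle_im]; last first.
  apply: big1 => j _; rewrite mcoeffZ -mpolyXD mcoeffX.
  by case: eqP nle_im => [<- | _ _]; rewrite ?lem_addr // mulr0.
rewrite /bil evec_midx_val -rowE mxE; apply: eq_bigr => j _.
rewrite mcoeffZ -mpolyXD mcoeffX !mxE; congr (_ * _%:R).
by rewrite -[in LHS](submK le_im) [(_ - _ + _)%MM]addmC eqm_add2l.
Qed.

Lemma gram_matrixD f g G H :
  gram_matrix f G -> gram_matrix g H -> gram_matrix (f + g) (G + H).
Proof.
move=> [[symG fE] [_ posG]] [[symH gE] [_ posH]].
have symGH : (G + H)^T = G + H by rewrite linearD /= symG symH.
do 2!split=> //; last first.
  by move=> v; rewrite mulmxDr mulmxDl mxE addr_ge0.
rewrite fE gE -big_split; apply: eq_bigr => i _; rewrite -big_split.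
by apply: eq_bigr => j _; rewrite mxE scalerDl.
Qed.

Lemma gram_matrixZ c f G :
  0 <= c -> gram_matrix f G -> gram_matrix (c *: f) (c *: G).
Proof.
move=> c_ge0 [[symG fE] [_ posG]].
have symcG : (c *: G)^T = c *: G by rewrite linearZ /= symG.
do 2!split=> //; last first.
  by move=> v; rewrite -scalemxAr -scalemxAl mxE mulr_ge0.
rewrite fE scaler_sumr; apply: eq_bigr => i _; rewrite scaler_sumr.
by apply: eq_bigr => j _; rewrite mxE scalerA.
Qed.

Lemma dhomog_midx g : g \is p.-homog ->
  g = \sum_(i : 'I_N) g@_(midx_val i) *: 'X_[midx_val i].
Proof.
move=> hg; apply/mpolyP => m; rewrite raddf_sum /=.
have [dm | dm] := eqVneq (mdeg m) p.
  have [i <-] := midx_val_surj dm.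
  rewrite (bigD1 i) //= mcoeffZ mcoeffX eqxx mulr1 big1 ?addr0 // => j ji.
  by rewrite mcoeffZ mcoeffX (inj_eq midx_val_inj) (negPf ji) mulr0.
rewrite (dhomog_nemf_coeff hg) // big1 // => j _.
rewrite mcoeffZ mcoeffX; case: eqP => [jm | _]; last by rewrite mulr0.
by rewrite -jm mdeg_midx_val eqxx in dm.
Qed.

(** The Gram matrix is [c^T c], where [c] is the coefficient vector of [g]. *)
Lemma gram_matrix_sqr g : g \is p.-homog ->
  exists G, gram_matrix (g ^+ 2) G.
Proof.
move=> hg; pose c : 'rV[R]_N := \row_i g@_(midx_val i).
have sym : (c^T *m c)^T = c^T *m c by rewrite trmx_mul trmxK.
exists (c^T *m c); do 2!split=> //; last first.
  move=> v; rewrite mulmxA -mulmxA -{1}[v]trmxK -trmx_mul mxE big_ord1.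
  by rewrite [(c *m v^T)^T _ _]mxE -expr2 sqr_ge0.
rewrite [in LHS](dhomog_midx hg) expr2 mulr_suml; apply: eq_bigr => i _.
rewrite mulr_sumr; apply: eq_bigr => j _.
by rewrite mxE big_ord1 !mxE -scalerAl -scalerAr scalerA.
Qed.

End Forms.

(** * Explicit monomials in w, x, y, z *)

(** Coordinates are given explicitly so that equality, order, sum and difference
    of multi-indices reduce to computations on naturals. *)
Definition mon (a b c d : nat) : 'X_{1..4} := Multinom [tuple a; b; c; d].

Arguments mon : simpl never.

Lemma mon_eta (m : 'X_{1..4}) : exists a b c d, m = mon a b c d.
Proof.
case: m => [[[|a [|b [|c [|d [|e s]]]]] //= sz]].
by exists a, b, c, d; congr Multinom; apply: val_inj.
Qed.

Lemma mon_eq a b c d a' b' c' d' :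
  (mon a b c d == mon a' b' c' d') = [&& a == a', b == b', c == c' & d == d'].
Proof.
by rewrite -[LHS]/([:: _; _; _; _] == [:: _; _; _; _]) !eqseq_cons andbT.
Qed.

Lemma forall_ord4 (P : 'I_4 -> Prop) :
  P (@Ordinal 4 0 isT) -> P (@Ordinal 4 1 isT) ->
  P (@Ordinal 4 2 isT) -> P (@Ordinal 4 3 isT) -> forall i, P i.
Proof.
move=> P0 P1 P2 P3 [[|[|[|[|i]]]] //= lti];
  by rewrite (bool_irrelevance lti isT).
Qed.

Lemma monD a b c d a' b' c' d' :
  (mon a b c d + mon a' b' c' d')%MM = mon (a + a') (b + b') (c + c') (d + d').
Proof. by apply/mnmP; apply: forall_ord4; rewrite mnmDE. Qed.

Lemma monB a b c d a' b' c' d' :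
  (mon a b c d - mon a' b' c' d')%MM = mon (a - a') (b - b') (c - c') (d - d').
Proof. by apply/mnmP; apply: forall_ord4; rewrite mnmBE. Qed.

Lemma mon_le a b c d a' b' c' d' :
  (mon a b c d <= mon a' b' c' d')%MM =
  [&& a <= a', b <= b', c <= c' & d <= d']%N.
Proof.
apply/mnm_lepP/and4P => [le | [le0 le1 le2 le3]].
  split; [exact: (le (@Ordinal 4 0 isT)) | exact: (le (@Ordinal 4 1 isT))
         | exact: (le (@Ordinal 4 2 isT)) | exact: (le (@Ordinal 4 3 isT))].
exact: forall_ord4.
Qed.

Lemma mdeg_mon a b c d : mdeg (mon a b c d) = (a + b + c + d)%N.
Proof. by rewrite mdegE !big_ord_recl big_ord0 addn0 !addnA. Qed.

Definition quadrics : seq 'X_{1..4} :=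
  [:: mon 2 0 0 0; mon 0 2 0 0; mon 0 0 2 0; mon 0 0 0 2;
      mon 1 1 0 0; mon 1 0 1 0; mon 1 0 0 1;
      mon 0 0 1 1; mon 0 1 0 1; mon 0 1 1 0].

Lemma mem_quadrics m : (m \in quadrics) = (mdeg m == 2).
Proof.
have [a [b [c [d ->]]]] := mon_eta m.
rewrite mdeg_mon !inE !mon_eq.
by case: a => [|[|[|a]]]; case: b => [|[|[|b]]]; case: c => [|[|[|c]]];
   case: d => [|[|[|d]]].
Qed.

Lemma big_midx (V : nmodType) (P : pred 'X_{1..4}) (F : 'X_{1..4} -> V) :
  \sum_(i : 'I_#|midx 4 2| | P (midx_val i)) F (midx_val i) =
  \sum_(m <- quadrics | P m) F m.
Proof.
rewrite -(big_map (@midx_val 4 2) P F); apply: perm_big.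
apply: uniq_perm => [||m].
- by rewrite map_inj_uniq ?index_enum_uniq //; apply: midx_val_inj.
- by [].
rewrite mem_quadrics; apply/mapP/eqP => [[i _ ->] | /midx_val_surj [i <-]].
  exact: mdeg_midx_val.
by exists i => //; rewrite mem_index_enum.
Qed.

Section Quaternary.
Variable R : realType.
Local Notation N := #|midx 4 2|.
Implicit Types (f g : {mpoly R[4]}) (G : 'M[R]_N).

Lemma VwE : Vw = 'X_[mon 1 0 0 0] :> {mpoly R[4]}.
Proof. by congr mpolyX; apply/mnmP; apply: forall_ord4; rewrite mnm1E. Qed.
Lemma VxE : Vx = 'X_[mon 0 1 0 0] :> {mpoly R[4]}.
Proof. by congr mpolyX; apply/mnmP; apply: forall_ord4; rewrite mnm1E. Qed.
Lemma VyE : Vy = 'X_[mon 0 0 1 0] :> {mpoly R[4]}.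
Proof. by congr mpolyX; apply/mnmP; apply: forall_ord4; rewrite mnm1E. Qed.
Lemma VzE : Vz = 'X_[mon 0 0 0 1] :> {mpoly R[4]}.
Proof. by congr mpolyX; apply/mnmP; apply: forall_ord4; rewrite mnm1E. Qed.

Definition ev a b c d : 'rV[R]_N := evec R 2 (mon a b c d).

(** The contribution of row (a', b', c', d') to the coefficient of
    w^a x^b y^c z^d. *)
Definition coef_term G a b c d a' b' c' d' : R :=
  if [&& a' <= a, b' <= b, c' <= c & d' <= d]%N
  then bil G (ev a' b' c' d') (ev (a - a') (b - b') (c - c') (d - d')) else 0.

(** The summation order is that of [quadrics]. *)
Lemma quartic_coef f G a b c d : representation_matrix f G ->
  f@_(mon a b c d) =
    coef_term G a b c d 2 0 0 0 +
    (coef_term G a b c d 0 2 0 0 +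
    (coef_term G a b c d 0 0 2 0 +
    (coef_term G a b c d 0 0 0 2 +
    (coef_term G a b c d 1 1 0 0 +
    (coef_term G a b c d 1 0 1 0 +
    (coef_term G a b c d 1 0 0 1 +
    (coef_term G a b c d 0 0 1 1 +
    (coef_term G a b c d 0 1 0 1 +
    coef_term G a b c d 0 1 1 0)))))))).
Proof.
move=> repf; rewrite (representation_coef _ repf).
rewrite (big_midx (fun m => m <= mon a b c d)%MM
  (fun m => bil G (evec R 2 m) (evec R 2 (mon a b c d - m)%MM))).
rewrite big_mkcond /quadrics !big_cons big_nil
  -[in RHS](addr0 (coef_term _ _ _ _ _ 0 1 1 0)).
by rewrite !monB !mon_le.
Qed.

(** * The dual functional *)

Definition moment (s : R) f : R :=
  (3 * s) * f@_(mon 4 0 0 0)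
  + (f@_(mon 2 2 0 0) + f@_(mon 2 0 2 0) + f@_(mon 2 0 0 2))
  + (s^-1 - 18 * s ^+ 2)
    * (f@_(mon 0 4 0 0) + f@_(mon 0 0 4 0) + f@_(mon 0 0 0 4))
  + (9 * s ^+ 2) * (f@_(mon 0 2 2 0) + f@_(mon 0 0 2 2) + f@_(mon 0 2 0 2))
  + (3 * s) * f@_(mon 1 1 1 1).

(** Up to positive weights, the moment matrix of [moment s] is the sum of the
    [v^T v] for the following seven vectors [v], indexed by quadratic monomials;
    the last three are linearly dependent. *)
Definition mvec_w (s : R) :=
  ev 2 0 0 0 + (3 * s)^-1 *: (ev 0 2 0 0 + ev 0 0 2 0 + ev 0 0 0 2).
Definition mvec_wx (s : R) := ev 1 1 0 0 + (3 * s) *: ev 0 0 1 1.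
Definition mvec_wy (s : R) := ev 1 0 1 0 + (3 * s) *: ev 0 1 0 1.
Definition mvec_wz (s : R) := ev 1 0 0 1 + (3 * s) *: ev 0 1 1 0.
Definition mvec_xy := ev 0 2 0 0 + (-1) *: ev 0 0 2 0.
Definition mvec_yz := ev 0 0 2 0 + (-1) *: ev 0 0 0 2.
Definition mvec_zx := ev 0 0 0 2 + (-1) *: ev 0 2 0 0.

Definition moment_vectors (s : R) : seq 'rV[R]_N :=
  [:: mvec_w s; mvec_wx s; mvec_wy s; mvec_wz s; mvec_xy; mvec_yz; mvec_zx].

(** Both sides are linear in the entries of [G], so this is the factorization of
    the moment matrix, read off entry by entry. *)
Lemma moment_gram s f G : s != 0 -> representation_matrix f G ->
  moment s f =
    3 * s * bil G (mvec_w s) (mvec_w s)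
    + (bil G (mvec_wx s) (mvec_wx s) + bil G (mvec_wy s) (mvec_wy s)
       + bil G (mvec_wz s) (mvec_wz s))
    + ((3 * s)^-1 - 9 * s ^+ 2) *
      (bil G mvec_xy mvec_xy + bil G mvec_yz mvec_yz + bil G mvec_zx mvec_zx).
Proof.
move=> s0 repf.
have coef a b c d := quartic_coef a b c d repf.
rewrite /moment !coef /coef_term /= !(subSS, subn0).
rewrite /mvec_w /mvec_wx /mvec_wy /mvec_wz /mvec_xy /mvec_yz /mvec_zx !bilE.
by field.
Qed.

Lemma moment_q_form s eta :
  moment s (q_form eta) = 27 * s ^+ 2 - 9 * s + 3 * (s^-1 - 18 * s ^+ 2) * eta.
Proof.
rewrite /q_form VwE VxE VyE VzE /moment.
rewrite !exprS !expr0 !mulr1 -!mpolyXD !monD.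
rewrite !(mcoeffN, mcoeffD, mcoeffZ, mcoeffX) !mon_eq /=.
ring.
Qed.
End Quaternary.

(** * The least positive root of the cubic *)

Section Cubic.
Variable R : realType.

Definition cubic : {poly R} := 'X^3 - (1 / 2%:R) *: 'X + (1 / 9%:R)%:P.

Lemma cubicE u : cubic.[u] = u ^+ 3 - u / 2 + 1 / 9.
Proof. by rewrite /cubic !hornerE; field. Qed.

(** The cubic changes sign between 0 and 1/3.  Two of its roots [u < s] satisfy
    s^2 + s u + u^2 = 1/2, which is impossible for 0 < u < s < 1/3. *)
Lemma cubic_smallest_pos_root :
  exists s, [/\ 0 < s, 3 * s < 1 & smallest_pos_root cubic s].
Proof.
have [s /andP[s_ge0 s_le]] : exists2 s, 0 <= s <= 1 / 3 & root (- cubic) s.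
  have [||s s_in rs] := @poly_ivt R (- cubic) 0 (1 / 3).
  - lra.
  - by rewrite !hornerN !cubicE; apply/andP; split; lra.
  - by exists s.
rewrite rootN => rs.
have rootE u : root cubic u -> u ^+ 3 - u / 2 + 1 / 9 = 0.
  by move=> /rootP; rewrite cubicE.
have s_gt0 : 0 < s.
  rewrite lt_neqAle s_ge0 andbT; apply/eqP => s0.
  by have := rootE s rs; rewrite -s0; lra.
have s_lt : 3 * s < 1.
  suff s_neq : s != 1 / 3 by (have : s < 1 / 3 by rewrite lt_neqAle s_neq); lra.
  by apply/eqP => s3; have := rootE s rs; rewrite s3; lra.
exists s; split=> //; split=> // u u_gt0 ru.
rewrite leNgt; apply/negP => u_lt.
have eqs := rootE s rs; have equ := rootE u ru.
have : (s - u) * (s ^+ 2 + s * u + u ^+ 2 - 1 / 2) = 0.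
  have -> : (s - u) * (s ^+ 2 + s * u + u ^+ 2 - 1 / 2) =
    (s ^+ 3 - s / 2 + 1 / 9) - (u ^+ 3 - u / 2 + 1 / 9) by field.
  by rewrite eqs equ subrr.
move=> /eqP; rewrite mulf_eq0 subr_eq0 (gt_eqF u_lt) /= => /eqP.
have : s * u <= s * s by rewrite ler_wpM2l // ltW.
have : u * u <= s * u by rewrite ler_wpM2r // ltW.
have : s * (3 * s) < s * 1 by rewrite ltr_pM2l.
rewrite !expr2; lra.
Qed.
End Cubic.

(** * Positivity of the dual functional and complementary slackness *)

Section Moment.
Variable R : realType.
Local Notation N := #|midx 4 2|.
Implicit Types (f g : {mpoly R[4]}) (G H D : 'M[R]_N) (s : R).

Lemma moment0 s : moment s 0 = 0.
Proof. by rewrite /moment !mcoeff0; ring. Qed.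

Lemma momentD s f g : moment s (f + g) = moment s f + moment s g.
Proof.
rewrite /moment !mcoeffD.
(* Abstracting the coefficients spares ring comparing them as terms. *)
do 11![move: (f@_(mon _ _ _ _)) => ?]; do 11![move: (g@_(mon _ _ _ _)) => ?].
ring.
Qed.

Lemma moment_nquartic s d f :
  f \is d.-homog -> d != 4 -> moment s f = 0.
Proof.
move=> hf d4; have coef0 (m : 'X_{1..4}) : mdeg m = 4 -> f@_m = 0.
  by move=> dm; apply: (dhomog_nemf_coeff hf); rewrite [X in X != _]dm eq_sym.
by rewrite /moment !coef0 ?mdeg_mon //; ring.
Qed.

Section Weights.
Variable s : R.
Hypotheses (s_gt0 : 0 < s) (s_lt : 3 * s < 1).

(** The weight of [mvec_xy], [mvec_yz], [mvec_zx] in [moment_gram]. *)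
Lemma moment_weight_gt0 : 0 < (3 * s)^-1 - 9 * s ^+ 2.
Proof.
have -> : (3 * s)^-1 - 9 * s ^+ 2 = (1 - (3 * s) ^+ 3) / (3 * s).
  by field; rewrite gt_eqF.
rewrite divr_gt0 ?mulr_gt0 // subr_gt0 exprn_ilt1 // mulr_ge0 ?ltW //.
Qed.

(** The value of [moment s] on x^4, y^4, z^4. *)
Lemma moment_x4_gt0 : 0 < s^-1 - 18 * s ^+ 2.
Proof.
have := moment_weight_gt0; have := exprn_gt0 2 s_gt0.
rewrite invfM; lra.
Qed.

Lemma moment_gram_ge0 f G : gram_matrix f G -> 0 <= moment s f.
Proof.
case=> repf [_ psdG]; rewrite (moment_gram _ repf) ?gt_eqF //.
have ge0 v : 0 <= bil G v v by apply: psdG.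
(* The weight is abstracted to keep addr_ge0 from splitting the difference. *)
move: (ltW s_gt0) (ltW moment_weight_gt0).
move: (_ - 9 * _) => w s_ge0 w_ge0.
by rewrite !(addr_ge0, mulr_ge0).
Qed.

(** A summand of degree 2 has a square with a Gram matrix; the square of a summand
    of any other degree has no quartic term. *)
Lemma moment_sos_ge0 f : sos_forms f -> 0 <= moment s f.
Proof.
case=> t [homt ->]; elim: t homt => [|g t IHt] homt.
  by rewrite big_nil moment0.
rewrite big_cons momentD addr_ge0 //; last first.
  by apply: IHt => h ht; apply: homt; rewrite in_cons ht orbT.
have [d hg] := homt g (mem_head _ _).
have [d2 | d2] := eqVneq d 2%N.
  by rewrite d2 in hg; have [G] := gram_matrix_sqr hg; apply: moment_gram_ge0.
rewrite (moment_nquartic _ (dhomogMn 2 hg)) //.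
by case: d d2 {hg} => [|[|[|d]]].
Qed.

(** In [moment_gram] all summands are nonnegative, so all of them vanish. *)
Lemma moment_gram_kernel f G :
  gram_matrix f G -> moment s f = 0 ->
  {in moment_vectors s, forall v, v *m G = 0}.
Proof.
move=> gramG mom0.
case: (gramG) => repf psdG.
have ge0 v : 0 <= bil G v v by case: psdG => _; apply.
have s3_gt0 : 0 < 3 * s by rewrite mulr_gt0.
move: mom0 moment_weight_gt0; rewrite (moment_gram _ repf) ?gt_eqF // => /eqP.
move: ((3 * s)^-1 - 9 * s ^+ 2) => w mom0 w_gt0.
move: (3 * s) s3_gt0 mom0 => s3 s3_gt0.
rewrite !paddr_eq0 ?(addr_ge0, mulr_ge0) // ?(ltW w_gt0) ?(ltW s3_gt0) //.
rewrite !mulf_eq0 !paddr_eq0 ?(addr_ge0, mulr_ge0) //.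
rewrite (gt_eqF w_gt0) (gt_eqF s3_gt0) /=.
case/andP => /andP[/eqP b0 /andP[/andP[/eqP b1 /eqP b2] /eqP b3]].
case/andP => /andP[/eqP b4 /eqP b5] /eqP b6.
by move=> v; rewrite !inE => /or4P[|||/or4P[]] /eqP ->;
  apply: psdmx_isotropic_kernel.
Qed.

(** Killing the moment vectors makes the row of every quadratic monomial a
    multiple of the row of w^2, wx, wy or wz.  The entries of [D] at pairs of these four
    monomials then vanish successively, by comparing the coefficients of w^4,
    w^3 x, w^2 x^2, w^2 y z and their permutations. *)
Lemma representation_matrix0_kernel D :
  representation_matrix 0 D ->
  {in moment_vectors s, forall v, v *m D = 0} -> D = 0.
Proof.
move=> rep0 kerD; have symD : D^T = D by case: rep0.
have s_neq0 : s != 0 by rewrite gt_eqF.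
have ker v u : v \in moment_vectors s -> bil D v u = 0.
  by move=> /kerD vD0; rewrite /bil vD0 mul0mx mxE.
have solve (x y : R) : x + 3 * s * y = 0 -> y = - (3 * s)^-1 * x.
  move=> h; have -> : y = (x + 3 * s * y - x) / (3 * s) by field.
  by rewrite h; field.
have yzE u : bil D (ev R 0 0 1 1) u = - (3 * s)^-1 * bil D (ev R 1 1 0 0) u.
  by apply: solve; rewrite -bilZl -bilDl; apply: ker; rewrite !inE eqxx !orbT.
have zxE u : bil D (ev R 0 1 0 1) u = - (3 * s)^-1 * bil D (ev R 1 0 1 0) u.
  by apply: solve; rewrite -bilZl -bilDl; apply: ker; rewrite !inE eqxx !orbT.
have xyE u : bil D (ev R 0 1 1 0) u = - (3 * s)^-1 * bil D (ev R 1 0 0 1) u.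
  by apply: solve; rewrite -bilZl -bilDl; apply: ker; rewrite !inE eqxx !orbT.
have xx_yyE u : bil D (ev R 0 2 0 0) u = bil D (ev R 0 0 2 0) u.
  have := ker (mvec_xy R) u; rewrite !inE eqxx !orbT => /(_ isT).
  by rewrite !bilE mulN1r => /subr0_eq.
have yy_zzE u : bil D (ev R 0 0 2 0) u = bil D (ev R 0 0 0 2) u.
  have := ker (mvec_yz R) u; rewrite !inE eqxx !orbT => /(_ isT).
  by rewrite !bilE mulN1r => /subr0_eq.
have zzE u : bil D (ev R 0 0 0 2) u = - s * bil D (ev R 2 0 0 0) u.
  have := ker (mvec_w s) u; rewrite !inE eqxx => /(_ isT).
  rewrite !bilE xx_yyE yy_zzE.
  move: (bil D (ev R 2 0 0 0) u) (bil D (ev R 0 0 0 2) u) => w z wz0.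
  have -> : w = - ((3 * s)^-1 * (z + z + z)) by lra.
  by field.
have redE := (xx_yyE, yy_zzE, zzE, yzE, zxE, xyE).
have coef (i j k l : nat) := quartic_coef i j k l rep0.
have simp := (addr0, add0r, subSS, subn0, mulr0).
have sym0 u v : bil D u v + bil D v u = 0 -> bil D u v = 0.
  by rewrite [bil D v u]bilC // => uv0; lra.
(* The pairings of w^2 with w^2, wx, wy and wz. *)
have ww0 : bil D (ev R 2 0 0 0) (ev R 2 0 0 0) = 0.
  by have := coef 4 0 0 0; rewrite mcoeff0 /coef_term /= !simp.
have wx0 : bil D (ev R 2 0 0 0) (ev R 1 1 0 0) = 0.
  by apply: sym0; have := coef 3 1 0 0; rewrite mcoeff0 /coef_term /= !simp.
have wy0 : bil D (ev R 2 0 0 0) (ev R 1 0 1 0) = 0.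
  by apply: sym0; have := coef 3 0 1 0; rewrite mcoeff0 /coef_term /= !simp.
have wz0 : bil D (ev R 2 0 0 0) (ev R 1 0 0 1) = 0.
  by apply: sym0; have := coef 3 0 0 1; rewrite mcoeff0 /coef_term /= !simp.
(* In the remaining coefficients the terms with w^2 reduce to these pairings. *)
have wE := bilC (ev R 2 0 0 0) _ symD.
have xx0 : bil D (ev R 1 1 0 0) (ev R 1 1 0 0) = 0.
  have := coef 2 2 0 0.
  by rewrite mcoeff0 /coef_term /= !simp wE !redE ww0 !simp.
have yy0 : bil D (ev R 1 0 1 0) (ev R 1 0 1 0) = 0.
  have := coef 2 0 2 0.
  by rewrite mcoeff0 /coef_term /= !simp wE !redE ww0 !simp.
have zz0 : bil D (ev R 1 0 0 1) (ev R 1 0 0 1) = 0.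
  have := coef 2 0 0 2.
  by rewrite mcoeff0 /coef_term /= !simp wE !redE ww0 !simp.
have yz0 : bil D (ev R 1 0 1 0) (ev R 1 0 0 1) = 0.
  apply: sym0; have := coef 2 0 1 1.
  by rewrite mcoeff0 /coef_term /= !simp wE !redE -wE wx0 !simp.
have zx0 : bil D (ev R 1 0 0 1) (ev R 1 1 0 0) = 0.
  apply: sym0; have := coef 2 1 0 1.
  by rewrite mcoeff0 /coef_term /= !simp wE !redE -wE wy0 !simp addrC.
have xy0 : bil D (ev R 1 1 0 0) (ev R 1 0 1 0) = 0.
  apply: sym0; have := coef 2 1 1 0.
  by rewrite mcoeff0 /coef_term /= !simp wE !redE -wE wz0 !simp.
pose orth u := [/\ bil D (ev R 2 0 0 0) u = 0, bil D (ev R 1 1 0 0) u = 0,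
  bil D (ev R 1 0 1 0) u = 0 & bil D (ev R 1 0 0 1) u = 0].
have orth_all u : orth u -> {in quadrics, forall m, bil D (evec R 2 m) u = 0}.
  move=> [u0 u1 u2 u3] m.
  by rewrite !inE => /or4P[|||/or4P[|||/or4P[]]] /eqP ->;
    rewrite -/(ev R _ _ _ _) ?redE ?u0 ?u1 ?u2 ?u3 ?mulr0.
have midx_quadrics (k : 'I_N) : midx_val k \in quadrics.
  by rewrite mem_quadrics mdeg_midx_val.
apply/matrixP => i j; rewrite mxE -bil_evec; apply: (orth_all _) => //.
split; rewrite bilC //; apply: (orth_all _) => //; split=> //;
  by rewrite bilC.
Qed.
End Weights.

Lemma representation_matrixB f G H :
  representation_matrix f G -> representation_matrix f H ->
  representation_matrix 0 (G - H).
Proof.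
move=> [symG fG] [symH fH]; split; first by rewrite linearB /= symG symH.
rewrite -[LHS](subrr f) [X in X - _]fG [X in _ - X]fH -sumrB.
apply: eq_bigr => i _; rewrite -sumrB.
by apply: eq_bigr => j _; rewrite !mxE scalerBl.
Qed.

End Moment.

(** * The extremal form *)

Section Main.
Variables (R : realType) (s : R).
Hypotheses (s_gt0 : 0 < s) (s_lt : 3 * s < 1) (rs : root (cubic R) s).

Let s_neq0 : s != 0. Proof. by rewrite gt_eqF. Qed.

Let cubic_s : 18 * s ^+ 3 = 9 * s - 2.
Proof. by have := rootP rs; rewrite cubicE; lra. Qed.

Definition base_w := Vw ^+ 2 - s *: (Vx ^+ 2 + Vy ^+ 2 + Vz ^+ 2).
Definition base_x := (3%:R * s) *: (Vw * Vx) - Vy * Vz.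
Definition base_y := (3%:R * s) *: (Vw * Vy) - Vz * Vx.
Definition base_z := (3%:R * s) *: (Vw * Vz) - Vx * Vy.

Lemma q_form_decomposition :
  q_form (s ^+ 2) =
    base_w ^+ 2
    + (2%:R / (9%:R * s)) *: (base_x ^+ 2 + base_y ^+ 2 + base_z ^+ 2).
Proof.
have -> : 2%:R / (9%:R * s) = 1 - 2 * s ^+ 2.
  have two : 2%:R = 9 * s - 18 * s ^+ 3 by rewrite cubic_s; ring.
  by rewrite [in LHS]two; field.
have := congr1 (@mpolyC 4 R) cubic_s.
rewrite /q_form /base_w /base_x /base_y /base_z -!mul_mpolyC.
rewrite !(rmorphM, rmorphB, rmorphXn, rmorph_nat, rmorph1) /=.
move: s%:MP Vw Vx Vy Vz => S w x y z key.
(* The cofactor of the cubic is found on comparing the coefficients of w^2 x^2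
   and w x y z; those of x^2 y^2 agree. *)
apply/subr0_eq; transitivity ((18 * (S * (S * S)) - (9 * S - 2)) *
  (S * w ^+ 2 * (x ^+ 2 + y ^+ 2 + z ^+ 2) - 2 * (w * x * y * z))).
  by ring.
by rewrite key subrr mul0r.
Qed.

Let homog_XX (i j : 'I_4) : ('X_i * 'X_j : {mpoly R[4]}) \is 2.-homog.
Proof.
have homog_X k : 'X_k \is [in R[4], 1.-homog].
  by rewrite dhomogX; apply/eqP/mdeg1.
exact: (dhomogM (homog_X i) (homog_X j)).
Qed.

Lemma base_w_homog : base_w \is 2.-homog.
Proof. by rewrite /base_w !expr2 rpredB ?rpredZ ?rpredD ?homog_XX. Qed.
Lemma base_x_homog : base_x \is 2.-homog.
Proof. by rewrite rpredB ?rpredZ ?homog_XX. Qed.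
Lemma base_y_homog : base_y \is 2.-homog.
Proof. by rewrite rpredB ?rpredZ ?homog_XX. Qed.
Lemma base_z_homog : base_z \is 2.-homog.
Proof. by rewrite rpredB ?rpredZ ?homog_XX. Qed.

Let weight_ge0 : 0 <= 2%:R / (9%:R * s).
Proof. by rewrite divr_ge0 // mulr_ge0 // ltW. Qed.

Lemma q_form_sos : sos_forms (q_form (s ^+ 2)).
Proof.
pose r := Num.sqrt (2%:R / (9%:R * s)).
exists [:: base_w; r *: base_x; r *: base_y; r *: base_z]; split.
  move=> g; rewrite !inE => /or4P[] /eqP ->; exists 2%N;
    by rewrite ?rpredZ // ?(base_w_homog, base_x_homog)
      ?(base_y_homog, base_z_homog).
rewrite q_form_decomposition !big_cons big_nil addr0 !exprZn sqr_sqrtr //.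
by rewrite -!scalerDr !addrA.
Qed.

Lemma q_form_gram :
  exists G : 'M[R]_#|midx 4 2|, gram_matrix (q_form (s ^+ 2)) G.
Proof.
have [Gw gram_w] := gram_matrix_sqr base_w_homog.
have [Gx gram_x] := gram_matrix_sqr base_x_homog.
have [Gy gram_y] := gram_matrix_sqr base_y_homog.
have [Gz gram_z] := gram_matrix_sqr base_z_homog.
rewrite q_form_decomposition; eexists; apply: (gram_matrixD gram_w).
apply: (gram_matrixZ weight_ge0); apply: gram_matrixD gram_z.
exact: gram_matrixD gram_x gram_y.
Qed.

Lemma moment_q_form_root eta :
  moment s (q_form eta) = 3 * (s^-1 - 18 * s ^+ 2) * (eta - s ^+ 2).
Proof.
(* The two sides differ by -54 s times the cubic. *)
rewrite moment_q_form; apply/subr0_eq.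
transitivity (- (3 * s) * (18 * s ^+ 3 - (9 * s - 2))); first by field.
by rewrite cubic_s subrr mulr0.
Qed.

Lemma q_form_sos_ge eta : sos_forms (q_form eta) -> s ^+ 2 <= eta.
Proof.
move=> /(moment_sos_ge0 s_gt0 s_lt).
by rewrite moment_q_form_root pmulr_rge0 ?subr_ge0 // mulr_gt0 // moment_x4_gt0.
Qed.

Lemma q_form_gram_unique (G H : 'M[R]_#|midx 4 2|) :
  gram_matrix (q_form (s ^+ 2)) G -> gram_matrix (q_form (s ^+ 2)) H -> G = H.
Proof.
have mom0 : moment s (q_form (s ^+ 2)) = 0.
  by rewrite moment_q_form_root subrr mulr0.
move=> gramG gramH; apply: subr0_eq; apply: (representation_matrix0_kernel s_gt0).
  exact: representation_matrixB gramG.1 gramH.1.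
move=> v vin; rewrite mulmxBr.
by rewrite !(moment_gram_kernel s_gt0 s_lt _ mom0 vin) // subrr.
Qed.

Lemma q_form_least : least_sos_eta (s ^+ 2).
Proof.
split; first exact: sqr_ge0; first exact: q_form_sos.
by move=> eta _; apply: q_form_sos_ge.
Qed.

End Main.

Theorem mainTheorem5 (R : realType) :
  (exists eta0 : R, 0 < eta0 /\ least_sos_eta eta0) /\
  (forall eta0 : R, least_sos_eta eta0 ->
    let s := Num.sqrt eta0 in
    [/\ smallest_pos_root ('X^3 - (1 / 2%:R) *: 'X + (1 / 9%:R)%:P) s,
        q_form eta0 =
          (Vw ^+ 2 - s *: (Vx ^+ 2 + Vy ^+ 2 + Vz ^+ 2)) ^+ 2
          + (2%:R / (9%:R * s)) *:
            (((3%:R * s) *: (Vw * Vx) - Vy * Vz) ^+ 2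
             + ((3%:R * s) *: (Vw * Vy) - Vz * Vx) ^+ 2
             + ((3%:R * s) *: (Vw * Vz) - Vx * Vy) ^+ 2)
      & exists! G : 'M[R]_#|midx 4 2|, gram_matrix (q_form eta0) G]).
Proof.
have [s [s_gt0 s_lt s_min]] := cubic_smallest_pos_root R.
have rs : root (cubic R) s by case: s_min.
have least := q_form_least s_gt0 s_lt rs.
split; first by exists (s ^+ 2); rewrite exprn_gt0.
move=> eta0 [eta0_ge0 sos min_eta0] /=.
have -> : eta0 = s ^+ 2.
  case: least => s2_ge0 s2_sos min_s2.
  by apply/le_anti; rewrite min_eta0 // min_s2.
rewrite sqrtr_sqr gtr0_norm //; split=> //; first exact: q_form_decomposition.
have [G gramG] := q_form_gram s_gt0 rs.
exists G; split=> // H; exact: q_form_gram_unique.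
Qed.
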